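(* Let $V\in \mathbf{Mod}(\operatorname{Sym}(4),3)$ be faithful and $2$-divisible. Then there is a $\operatorname{Sym}(4)$-module dim-isogeny $\varphi:\hat V\rightarrow V$ with domain $\hat V=\operatorname{std}(4,L)$ or $\hat V=\operatorname{std}^\sigma(4,L)$ for some $1$-dimensional subgroup $L\le V$; further, if $V$ has no elements of order $2$, then $\varphi$ is an isomorphism.
   Context: A modular universe $\mathcal{U}$ is a collection $\mathrm{Ob}(\mathcal U)$ of abelian groups (the modules of $\mathcal U$) together with a collection $\mathrm{Ar}(\mathcal U)$ of group homomorphisms between them (the compatible morphisms), closed under composition, with the following closure properties. (Inverses) If $f\in \mathrm{Ar}(\mathcal U)$ is an isomorphism, then $f^{-1}\in \mathrm{Ar}(\mathcal U)$. (Products) If $V_1,V_2\in \mathrm{Ob}(\mathcal U)$ and $f_1,f_2\in\mathrm{Ar}(\mathcal U)$, then $V_1\times V_2\in\mathrm{Ob}(\mathcal U)$, and $\mathrm{Ar}(\mathcal U)$ contains $f_1\times f_2$, the projections $V_1\times V_2\to V_i$, and the diagonal embeddings $V_1\to V_1^k$. (Sections) If $W\le V$ are in $\mathrm{Ob}(\mathcal U)$, then $V/W\in\mathrm{Ob}(\mathcal U)$ and $\mathrm{Ar}(\mathcal U)$ contains the inclusion $W\to V$ and the quotient map $V\to V/W$. (Kernels/images) If $f:V_1\to V_2$ is in $\mathrm{Ar}(\mathcal U)$, then $\ker f,\operatorname{im} f\in\mathrm{Ob}(\mathcal U)$, and for all $W_1,W_2\in\mathrm{Ob}(\mathcal U)$: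 if $W_1\le\ker f$, the induced map $V_1/W_1\to V_2$ is in $\mathrm{Ar}(\mathcal U)$; if $\operatorname{im} f\le W_2\le V_2$, the induced map $V_1\to W_2$ is in $\mathrm{Ar}(\mathcal U)$. ($\mathbb Z$-module structure) If $V\in\mathrm{Ob}(\mathcal U)$, then $\mathrm{Ar}(\mathcal U)$ contains the sum map $V\times V\to V$ and the multiplication-by-$n$ maps $V\to V$ for $n\in\mathbb{Z}$. An additive dimension on $\mathcal U$ is a function $\dim:\mathrm{Ob}(\mathcal U)\to\mathbb N$ such that $\dim V=\dim\ker f+\dim\operatorname{im} f$ for every $f:V\to W$ in $\mathrm{Ar}(\mathcal U)$. A $G$-module in $\mathcal U$ is a module $V\in\mathrm{Ob}(\mathcal U)$ with an action of the group $G$ by compatible morphisms. Submodules of $V$ are subgroups of $V$ belonging to $\mathrm{Ob}(\mathcal U)$; a $1$-dimensional subgroup $L\le V$ is a submodule with $\dim L=1$. A module $V$ is dim-connected if every proper submodule $W<V$ in $\mathcal U$ satisfies $\dim W<\dim V$. $\mathbf{Mod}(G,d)$ is the class of all dim-connected $G$-modules of dimension exactly $d$, in modular universes with an additive dimension (each module coming with its own universe). An abelian group $V$ is $p$-divisible if for every $v\in V$ there is $w\in V$ with $v=pw$. For an abelian group $L$ (with trivial $\operatorname{Sym}(n)$-action), $\operatorname{perm}(n,\mathbb Z)=\mathbb Ze_1\oplus\cdots\oplus\mathbb Ze_n$ with $\operatorname{Sym}(n)$ permuting the $e_i$ naturally, $\operatorname{std}(n,\mathbb Z)=\{\sum_i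 c_ie_i : c_i\in\mathbb Z,\ \sum_i c_i=0\}$, and $\operatorname{std}(n,L)=\operatorname{std}(n,\mathbb Z)\otimes_{\mathbb Z}L$. Let $\operatorname{sgn}(n,\mathbb Z)=\mathbb Z$ with $g\in\operatorname{Sym}(n)$ acting as multiplication by the signature of $g$; then $\operatorname{std}^\sigma(n,L)=\operatorname{sgn}(n,\mathbb Z)\otimes_{\mathbb Z}\operatorname{std}(n,L)$ with the diagonal action (i.e. the same group as $\operatorname{std}(n,L)$ with the action twisted by the signature). When $L\in\mathrm{Ob}(\mathcal U)$, $\operatorname{std}(n,L)$ and $\operatorname{std}^\sigma(n,L)$ are regarded as modules of $\mathcal U$ by identifying the underlying group with the kernel of the sum map $L^n\to L$. A dim-isogeny is a surjective compatible homomorphism whose kernel has dimension $0$; a $G$-module dim-isogeny is one commuting with the action of $G$. *)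

(* Defs.v *)
From HB Require Import structures.
From mathcomp Require Import all_boot all_order all_fingroup all_algebra.
From mathcomp Require Import boolp.

Set Implicit Arguments.
Unset Strict Implicit.
Unset Printing Implicit Defensive.

Import GRing.Theory.
Local Open Scope ring_scope.
Local Open Scope quotient_scope.

(* A subgroup of V is a zmodClosed V. Membership is boolean, but by classical
   logic every subset closed under subtraction is of this form. Its underlying
   abelian group is the subtype (subgrp S); the quotient V/S is {ideal_quot S},
   which despite the notation only requires S to be a subgroup. *)
Section Subgroup.
Variables (V : zmodType) (S : zmodClosed V).

Record subgrp : Type := SubGrp { subgrp_val : V; _ : subgrp_val \in S }.

HB.instance Definition _ := [isSub for subgrp_val].
HB.instance Definition _ := [Choice of subgrp by <:].
HB.instance Definition _ := [SubChoice_isSubZmodule of subgrp by <:].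
End Subgroup.

Section KernelImage.
Variables (V W : zmodType) (f : {additive V -> W}).

Definition ker : {pred V} := fun v => f v == 0.
Definition im : {pred W} := fun w => `[< exists v, f v = w >].

Fact ker_zmod_closed : zmod_closed ker.
Proof.
split=> [|u v]; rewrite !unfold_in ?raddf0 //.
by rewrite raddfB => /eqP-> /eqP->; rewrite subrr.
Qed.
HB.instance Definition _ := GRing.isZmodClosed.Build V ker ker_zmod_closed.

Fact im_zmod_closed : zmod_closed im.
Proof.
split=> [|u v]; first by apply/asboolP; exists 0; rewrite raddf0.
move=> /asboolP[x <-] /asboolP[y <-]; apply/asboolP.
by exists (x - y); rewrite raddfB.
Qed.
HB.instance Definition _ := GRing.isZmodClosed.Build W im im_zmod_closed.
End KernelImage.

Section ProductMap.
Variables (V1 V2 W1 W2 : zmodType).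
Variables (f1 : {additive V1 -> W1}) (f2 : {additive V2 -> W2}).

Definition prod_map (v : V1 * V2) : W1 * W2 := (f1 v.1, f2 v.2).

Fact prod_map_is_zmod_morphism : zmod_morphism prod_map.
Proof. by move=> u v; rewrite /prod_map !raddfB. Qed.
HB.instance Definition _ :=
  GRing.isZmodMorphism.Build _ _ prod_map prod_map_is_zmod_morphism.
End ProductMap.

Section ScalarMap.
Variables (n : int) (V : zmodType).

Definition mulz_map (v : V) : V := v *~ n.

Fact mulz_map_is_zmod_morphism : zmod_morphism mulz_map.
Proof. by move=> u v; rewrite /mulz_map mulrzBl. Qed.
HB.instance Definition _ :=
  GRing.isZmodMorphism.Build _ _ mulz_map mulz_map_is_zmod_morphism.
End ScalarMap.
Arguments mulz_map n {V} v.

(* V^n is the iterated binary product V * (V * ( ... * V)), so that V^1 is V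
   itself; only V^0, which is never used, is an ad hoc trivial group. *)
Fixpoint pow (V : zmodType) (n : nat) : zmodType :=
  match n with
  | 0 => {ffun 'I_0 -> V}
  | n'.+1 => match n' with
             | 0 => V
             | _.+1 => (V * pow V n')%type
             end
  end.

Section Powers.
Variable V : zmodType.

Fixpoint mkpow (n : nat) : ('I_n -> V) -> pow V n :=
  match n with
  | 0 => fun F => finfun F
  | n'.+1 =>
    match n' return (('I_n' -> V) -> pow V n') ->
                    ('I_n'.+1 -> V) -> pow V n'.+1 with
    | 0 => fun _ F => F ord0
    | n''.+1 => fun mk F => (F ord0, mk (fun i => F (lift ord0 i)))
    end (@mkpow n')
  end.

Fixpoint coord (n : nat) : pow V n -> 'I_n -> V :=
  match n with
  | 0 => fun x i => x i
  | n'.+1 =>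
    match n' return (pow V n' -> 'I_n' -> V) ->
                    pow V n'.+1 -> 'I_n'.+1 -> V with
    | 0 => fun _ x _ => x
    | n''.+1 => fun co x i =>
        if unlift ord0 i is Some j then co x.2 j else x.1
    end (@coord n')
  end.

Lemma coord_mkpow n (F : 'I_n -> V) : coord (mkpow F) =1 F.
Proof.
elim: n F => [|[|n] IHn] F i; first by rewrite /= ffunE.
  by rewrite /= (ord1 i).
rewrite [LHS]/=; case: unliftP => [j|] -> //.
exact: IHn.
Qed.

Lemma coord_inj n (x y : pow V n) : coord x =1 coord y -> x = y.
Proof.
elim: n x y => [|[|n] IHn] x y eq_xy; first exact/ffunP.
  exact: (eq_xy ord0).
case: x y eq_xy => [x1 x2] [y1 y2] eq_xy; congr (_, _).
  by have /= := eq_xy ord0; rewrite unlift_none.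
by apply: IHn => i; have /= := eq_xy (lift ord0 i); rewrite liftK.
Qed.

Lemma coordB n (x y : pow V n) i : coord (x - y) i = coord x i - coord y i.
Proof.
elim: n x y i => [|[|n] IHn] x y i //; first by rewrite /= !ffunE.
rewrite [LHS]/= [in RHS]/=; case: (unlift _ i) => [j|] //.
exact: IHn.
Qed.

Definition diag (n : nat) (v : V) : pow V n := mkpow (fun=> v).

Fact diag_is_zmod_morphism n : zmod_morphism (@diag n).
Proof.
by move=> u v; apply: coord_inj => i; rewrite coordB !coord_mkpow.
Qed.
HB.instance Definition _ n :=
  GRing.isZmodMorphism.Build _ _ (@diag n) (@diag_is_zmod_morphism n).

Definition sum_map (n : nat) (x : pow V n) : V := \sum_(i < n) coord x i.

Fact sum_map_is_zmod_morphism n : zmod_morphism (@sum_map n).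
Proof.
by move=> x y; rewrite /sum_map -sumrB; apply: eq_bigr => i _; rewrite coordB.
Qed.
HB.instance Definition _ n :=
  GRing.isZmodMorphism.Build _ _ (@sum_map n) (@sum_map_is_zmod_morphism n).
End Powers.

Arguments diag {V} n v.
Arguments sum_map {V} n x.

(* W <= V is rendered by a subgroup W of V with Ob (subgrp W). Induced maps are
   characterized by the commutation relation that determines them. *)
Record modular_universe := ModularUniverse {
  Ob : zmodType -> Prop;
  Ar : forall V W : zmodType, {additive V -> W} -> Prop;

  Ar_Ob : forall (V W : zmodType) (f : {additive V -> W}),
    Ar f -> Ob V /\ Ob W;
  Ar_comp : forall (V W X : zmodType)
      (f : {additive V -> W}) (g : {additive W -> X}),
    Ar f -> Ar g -> Ar (g \o f : {additive V -> X});

  Ar_inv : forall (V W : zmodType)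
      (f : {additive V -> W}) (g : {additive W -> V}),
    Ar f -> cancel f g -> cancel g f -> Ar g;

  Ob_prod : forall V1 V2 : zmodType, Ob V1 -> Ob V2 -> Ob (V1 * V2)%type;
  Ar_prod : forall (V1 V2 W1 W2 : zmodType)
      (f1 : {additive V1 -> W1}) (f2 : {additive V2 -> W2}),
    Ar f1 -> Ar f2 -> Ar (prod_map f1 f2);
  Ar_fst : forall V1 V2 : zmodType, Ob V1 -> Ob V2 ->
    Ar (fst : {additive V1 * V2 -> V1});
  Ar_snd : forall V1 V2 : zmodType, Ob V1 -> Ob V2 ->
    Ar (snd : {additive V1 * V2 -> V2});
  Ar_diag : forall (V : zmodType) (k : nat), Ob V -> (0 < k)%N ->
    Ar (diag k : {additive V -> pow V k});

  Ob_quot : forall (V : zmodType) (W : zmodClosed V),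
    Ob V -> Ob (subgrp W) -> Ob {ideal_quot W};
  Ar_incl : forall (V : zmodType) (W : zmodClosed V),
    Ob V -> Ob (subgrp W) -> Ar (val : {additive subgrp W -> V});
  Ar_quot : forall (V : zmodType) (W : zmodClosed V),
    Ob V -> Ob (subgrp W) ->
    Ar (\pi_({ideal_quot W}) : {additive V -> {ideal_quot W}});

  Ob_ker : forall (V1 V2 : zmodType) (f : {additive V1 -> V2}),
    Ar f -> Ob (subgrp (ker f));
  Ob_im : forall (V1 V2 : zmodType) (f : {additive V1 -> V2}),
    Ar f -> Ob (subgrp (im f));
  Ar_factor : forall (V1 V2 : zmodType) (f : {additive V1 -> V2})
      (W1 : zmodClosed V1) (g : {additive {ideal_quot W1} -> V2}),
    Ar f -> Ob (subgrp W1) -> {subset W1 <= ker f} ->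
    (forall v, g (\pi_({ideal_quot W1}) v) = f v) -> Ar g;
  Ar_corestr : forall (V1 V2 : zmodType) (f : {additive V1 -> V2})
      (W2 : zmodClosed V2) (g : {additive V1 -> subgrp W2}),
    Ar f -> Ob (subgrp W2) -> {subset im f <= W2} ->
    (forall v, val (g v) = f v) -> Ar g;

  Ar_add : forall V : zmodType, Ob V ->
    Ar (fst \+ snd : {additive V * V -> V});
  Ar_mulz : forall (V : zmodType) (n : int), Ob V ->
    Ar (mulz_map n : {additive V -> V})
}.

(* The dimension is a total function; its values outside Ob U are irrelevant. *)
Record additive_dimension (U : modular_universe) := AdditiveDimension {
  dimf :> zmodType -> nat;
  dim_additive : forall (V W : zmodType) (f : {additive V -> W}), Ar U f ->
    dimf V = (dimf (subgrp (ker f)) + dimf (subgrp (im f)))%N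
}.

Section Notions.
Variables (U : modular_universe) (dim : additive_dimension U).

Definition submodule (V : zmodType) (W : zmodClosed V) : Prop :=
  Ob U (subgrp W).

Definition dim_connected (V : zmodType) : Prop :=
  forall W : zmodClosed V, submodule W -> (exists v, v \notin W) ->
    (dim (subgrp W) < dim V)%N.

Definition dim_isogeny (V W : zmodType) (f : {additive V -> W}) : Prop :=
  [/\ Ar U f, forall w, exists v, f v = w & dim (subgrp (ker f)) = 0%N].
End Notions.

(* MathComp actions are right actions and permutations multiply as
   (s * t) i = t (s i): these two conventions cancel, so an {action 'S_n &-> V}
   is a left action of the usual symmetric group. *)
Definition is_Gmodule (U : modular_universe) (gT : finGroupType)
    (V : zmodType) (to : {action gT &-> V}) : Prop :=
  Ob U V /\
  forall g, exists2 f : {additive V -> V}, Ar U f & forall v, f v = to v g.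

Definition in_Mod (U : modular_universe) (dim : additive_dimension U)
    (gT : finGroupType) (d : nat) (V : zmodType) (to : {action gT &-> V}) :
    Prop :=
  [/\ is_Gmodule U to, dim V = d & dim_connected dim V].

(* action.faithful is restricted to actions on finite types. *)
Definition faithful_action (gT : finGroupType) (T : Type)
    (to : {action gT &-> T}) : Prop :=
  forall g, (forall x, to x g = x) -> g = 1%g.

Definition divisible (p : nat) (V : zmodType) : Prop :=
  forall v : V, exists w : V, v = w *+ p.

Definition equivariant (gT : finGroupType) (S T : Type)
    (toS : {action gT &-> S}) (toT : {action gT &-> T}) (f : S -> T) : Prop :=
  forall x g, f (toS x g) = toT (f x) g.

(* std(n, L) = std(n, Z) (x) L as the kernel of the sum map L^n -> L, with
   c (x) l corresponding to (c_1 l, ..., c_n l). Since g e_i = e_{g i}, the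
   coordinate of g x at i is the one of x at g^-1 i. *)
Section Standard.
Variables (n : nat) (L : zmodType).

Definition std : zmodType := subgrp (ker (@sum_map L n)).

Definition perm_pow (x : pow L n) (g : 'S_n) : pow L n :=
  mkpow (fun i => coord x (g^-1%g i)).

Lemma perm_pow_ker (x : std) (g : 'S_n) :
  perm_pow (val x) g \in ker (@sum_map L n).
Proof.
case: x => x /=; rewrite !unfold_in /= => /eqP x0; apply/eqP; rewrite -[RHS]x0.
rewrite {2}/sum_map (reindex_inj (@perm_inj _ g^-1%g)).
by apply: eq_bigr => i _; rewrite coord_mkpow.
Qed.

Definition std_act (x : std) (g : 'S_n) : std := SubGrp (perm_pow_ker x g).

Lemma coord_std_act (x : std) (g : 'S_n) i :
  coord (val (std_act x g)) i = coord (val x) (g^-1%g i).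
Proof. exact: coord_mkpow. Qed.

Fact std_act1 : std_act^~ 1%g =1 id.
Proof.
move=> x; apply/val_inj/coord_inj => i.
by rewrite coord_std_act invg1 perm1.
Qed.

Fact std_actM x : act_morph std_act x.
Proof.
move=> a b; apply/val_inj/coord_inj => i.
by rewrite !coord_std_act invMg permM.
Qed.

Definition std_action : {action 'S_n &-> std} := TotalAction std_act1 std_actM.

Definition stdsgn_act (x : std) (g : 'S_n) : std :=
  std_act x g *~ (-1) ^+ odd_perm g.

Lemma coord_stdsgn_act (x : std) (g : 'S_n) i :
  coord (val (stdsgn_act x g)) i =
  if odd_perm g then - coord (val x) (g^-1%g i) else coord (val x) (g^-1%g i).
Proof.
have coordN (y : pow L n) j : coord (- y) j = - coord y j.
  by rewrite -[in LHS]sub0r -(subrr y) !coordB subrr sub0r.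
rewrite /stdsgn_act; case: (odd_perm g); last first.
  by rewrite expr0 mulr1z coord_std_act.
by rewrite expr1 mulrN1z raddfN coordN coord_std_act.
Qed.

Fact stdsgn_act1 : stdsgn_act^~ 1%g =1 id.
Proof.
move=> x; apply/val_inj/coord_inj => i.
by rewrite coord_stdsgn_act odd_perm1 invg1 perm1.
Qed.

Fact stdsgn_actM x : act_morph stdsgn_act x.
Proof.
move=> a b; apply/val_inj/coord_inj => i.
rewrite !coord_stdsgn_act odd_permM invMg permM.
by case: (odd_perm a); case: (odd_perm b); rewrite /= ?opprK.
Qed.

Definition stdsgn_action : {action 'S_n &-> std} :=
  TotalAction stdsgn_act1 stdsgn_actM.
End Standard.

(* Main.v *)
(* Let p, q, r be the actions of (01), (12), (23). For an involution t commuting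
   with f, 2-divisibility gives rank f = rank (1 + t)f + rank (1 - t)f, where
   rank f = dim (im f). Applied to the Klein group {1, a, b, c} this yields
   3 = rank (1 + a + b + c) + 3 rank (1 + a - b - c), as the three nontrivial
   eigenspaces are conjugate. By connectedness a map of rank 0 vanishes, so by
   faithfulness P = 1 + a - b - c has rank 1 and 1 + a + b + c = 0. Since p
   commutes with P, the same splitting shows that p acts on L = im P as 1 or -1;
   replacing p, q, r by their opposites, which is the twist by the signature,
   one may assume that it is 1. Then
     l |-> (l0 + l1) + q (l0 + l2) + r q (l0 + l3)
   is equivariant on std(4, L), its kernel is killed by 4, and its image
   contains 8 V = V. *)
From HB Require Import structures.
Require Import Defs.
From mathcomp Require Import all_boot all_order all_fingroup all_algebra.
From mathcomp Require Import boolp zify.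

Set Implicit Arguments.
Unset Strict Implicit.
Unset Printing Implicit Defensive.

(* Defs is imported again because fingroup and vector shadow ker and coord. *)
Import Defs GRing.Theory.
Local Open Scope ring_scope.
Local Open Scope quotient_scope.

(** * Extensionality of bundled maps and subgroups *)

Lemma additive_ext (V W : zmodType) (f g : {additive V -> W}) :
  f =1 g -> f = g.
Proof.
case: f g => [f [[[f0 fD]]]] [g [[[g0 gD]]]] /= /funext eq_fg.
rewrite {}eq_fg in f0 fD *.
by rewrite (Prop_irrelevance f0 g0) (Prop_irrelevance fD gD).
Qed.

(** [dim] is a function of types, with no invariance under isomorphism assumed, so subgroups with
    the same elements must give equal types. *)
Lemma zmodClosed_ext (V : zmodType) (S T : zmodClosed V) : S =i T -> S = T.
Proof.
case: S T => [S [[SN] [SD]]] [T [[TN] [TD]]] /= eqST.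
have {}eqST : S = T by apply: funext => x; exact: (eqST x).
rewrite {}eqST in SN SD *.
by rewrite (Prop_irrelevance SN TN) (Prop_irrelevance SD TD).
Qed.

(** * Compatible morphisms and dimension *)

Section Compatible.
Variable U : modular_universe.
Implicit Types V W X : zmodType.

Lemma Ar_ext V W (f g : {additive V -> W}) : Ar U f -> f =1 g -> Ar U g.
Proof. by move=> Uf /additive_ext <-. Qed.

Lemma Ar_id V : Ob U V -> Ar U (idfun : {additive V -> V}).
Proof. by move=> /(Ar_mulz 1)/Ar_ext; apply=> v; exact: mulr1z. Qed.

Lemma Ar_opp V W (f : {additive V -> W}) : Ar U f -> Ar U (\- f).
Proof.
move=> Uf; have [_ /(Ar_mulz (-1)) UN] := Ar_Ob Uf.
by apply: (Ar_ext (Ar_comp Uf UN)) => v; exact: mulrN1z.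
Qed.

Lemma Ar_addf V W (f g : {additive V -> W}) :
  Ar U f -> Ar U g -> Ar U (f \+ g).
Proof.
move=> Uf Ug; have [UV UW] := Ar_Ob Uf.
have Ud : Ar U (diag 2 : {additive V -> pow V 2}) by exact: Ar_diag.
exact: (Ar_ext (Ar_comp Ud (Ar_comp (Ar_prod Uf Ug) (Ar_add UW)))).
Qed.

Lemma Ar_subf V W (f g : {additive V -> W}) :
  Ar U f -> Ar U g -> Ar U (f \- g).
Proof. by move=> Uf /Ar_opp/(Ar_addf Uf)/Ar_ext; apply. Qed.

Lemma Ob_pow V n : Ob U V -> (0 < n)%N -> Ob U (pow V n).
Proof.
move=> UV; elim: n => [|[|n] IHn] // _.
by apply: (Ob_prod UV); exact: IHn.
Qed.

End Compatible.

Section Coordinates.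
Variables (V : zmodType) (n : nat) (i : 'I_n).

Definition coord_at (x : pow V n) : V := coord x i.

Fact coord_at_is_zmod_morphism : zmod_morphism coord_at.
Proof. by move=> x y; exact: coordB. Qed.
HB.instance Definition _ :=
  GRing.isZmodMorphism.Build _ _ coord_at coord_at_is_zmod_morphism.
End Coordinates.

Lemma Ar_coord (U : modular_universe) (V : zmodType) n (i : 'I_n) :
  Ob U V -> Ar U (coord_at i : {additive pow V n -> V}).
Proof.
move=> UV; elim: n i => [[]//|[|n] IHn] i.
  exact: (Ar_ext (Ar_id UV)).
have UVn : Ob U (pow V n.+1) by exact: Ob_pow.
case: (unliftP ord0 i) => [j|] ->.
  apply: (Ar_ext (Ar_comp (Ar_snd UV UVn) (IHn j))) => x.
  by rewrite /coord_at [in RHS]/= liftK.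
apply: (Ar_ext (Ar_fst UV UVn)) => x.
by rewrite /coord_at [in RHS]/= unlift_none.
Qed.

Lemma Ar_sum_map (U : modular_universe) (V : zmodType) n :
  Ob U V -> (0 < n)%N -> Ar U (sum_map n : {additive pow V n -> V}).
Proof.
move=> UV; case: n => // n _.
have UVn : Ob U (pow V n.+1) by exact: Ob_pow.
suffices [f Uf fE] : exists2 f : {additive pow V n.+1 -> V},
    Ar U f & forall x, f x = sum_map n.+1 x by exact: (Ar_ext Uf).
rewrite /sum_map; elim: (index_enum _) => [|i s [f Uf fE]].
  exists (mulz_map 0 \o coord_at ord0).
    exact: (Ar_comp (Ar_coord _ UV) (Ar_mulz 0 UV)).
  by move=> x; rewrite big_nil /= /mulz_map mulr0z.
exists (coord_at i \+ f); first exact: (Ar_addf (Ar_coord i UV) Uf).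
by move=> x; rewrite big_cons /= fE.
Qed.

(** * Dimensions of kernels and images *)

Section Rank.
Variables (U : modular_universe) (dim : additive_dimension U).
Implicit Types V W X : zmodType.

Definition rank V W (f : {additive V -> W}) : nat := dim (subgrp (im f)).

Lemma rank_nullity V W (f : {additive V -> W}) :
  Ar U f -> dim V = (dim (subgrp (ker f)) + rank f)%N.
Proof. exact: dim_additive. Qed.

Lemma eq_dim V (S T : zmodClosed V) : S =i T -> dim (subgrp S) = dim (subgrp T).
Proof. by move=> /zmodClosed_ext ->. Qed.

Lemma im_val V (S : zmodClosed V) : im (val : {additive subgrp S -> V}) =i S.
Proof.
move=> v; apply/asboolP/idP => [[x <-]|Sv]; first exact: valP.
by exists (SubGrp Sv).
Qed.

(** Additivity for the identity does not directly say [dim V = dim V + dim V], since kernel and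
    image are subgroup types other than [V]. With d and e the dimensions of the full subgroups of
    [V] and of that subgroup, the identities and the inclusion give d = e + e, d = e + d and dim V =
    d + d. *)
Lemma dim_trivial V : Ob U V -> (forall v : V, v = 0) -> dim V = 0%N.
Proof.
move=> UV V0.
pose full : zmodClosed V := im (idfun : {additive V -> V}).
have Ufull : Ob U (subgrp full) := Ob_im (Ar_id UV).
have F0 (x : subgrp full) : x = 0 by apply: val_inj; rewrite [LHS]V0 [RHS]V0.
have eqF (S T : zmodClosed (subgrp full)) :
    dim (subgrp S) = dim (subgrp T).
  by apply: eq_dim => x; rewrite (F0 x) !rpred0.
pose d := dim (subgrp full).
pose e := dim (subgrp (im (idfun : {additive subgrp full -> subgrp full}))).
have dE : d = (e + e)%N.
  rewrite /d (rank_nullity (Ar_id Ufull)); congr (_ + _)%N; exact: eqF.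
have dE' : d = (e + d)%N.
  rewrite [LHS](rank_nullity (Ar_incl UV Ufull)); congr (_ + _)%N.
    exact: eqF.
  exact: (eq_dim (im_val full)).
have dV : dim V = (d + d)%N.
  rewrite (rank_nullity (Ar_id UV)); congr (_ + _)%N.
  by apply: eq_dim => v; rewrite (V0 v) !rpred0.
lia.
Qed.

Lemma rank_inj V W (f : {additive V -> W}) :
  Ar U f -> injective f -> rank f = dim V.
Proof.
move=> Uf f_inj; rewrite (rank_nullity Uf) (dim_trivial (Ob_ker Uf)) //.
case=> x x0; apply/val_inj/f_inj => /=.
by rewrite raddf0; apply/eqP.
Qed.

(** [S] is the kernel of the map from [T] to V/S, so additivity bounds its dimension. That kernel is
    a subgroup of [subgrp T]; its embedding [g] into [V], with image [S], shows that the dimensions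
    agree. *)
Lemma dim_sub V (S T : zmodClosed V) :
  Ob U V -> Ob U (subgrp S) -> Ob U (subgrp T) -> {subset S <= T} ->
  (dim (subgrp S) <= dim (subgrp T))%N.
Proof.
move=> UV US UT sST.
pose f := \pi_({ideal_quot S}) \o (val : {additive subgrp T -> V}).
have Uf : Ar U f := Ar_comp (Ar_incl UV UT) (Ar_quot UV US).
have fE x : (x \in ker f) = (val x \in S).
  rewrite unfold_in /= -(raddf0 \pi_({ideal_quot S}))
    -Quotient.idealrBE subr0 //.
have Uk := Ob_ker Uf.
pose g : {additive subgrp (ker f) -> V} := val \o val.
have Ug : Ar U g := Ar_comp (Ar_incl UT Uk) (Ar_incl UV UT).
rewrite (rank_nullity Uf) -(rank_inj Ug) => [|x y /val_inj/val_inj//].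
suffices -> : dim (subgrp S) = rank g.
  exact: leq_addr.
apply: eq_dim => v; apply/idP/asboolP => [Sv | [x <-]]; last first.
  by have := valP x; rewrite fE.
have kv : SubGrp (sST _ Sv) \in ker f by rewrite fE.
by exists (SubGrp kv).
Qed.

Lemma in_ker V W (f : {additive V -> W}) v : (v \in ker f) = (f v == 0).
Proof. by []. Qed.

Lemma rank_ker_sub V W X (f : {additive V -> W}) (g : {additive V -> X}) :
  Ar U f -> Ar U g -> {subset ker f <= ker g} -> (rank g <= rank f)%N.
Proof.
move=> Uf Ug /(dim_sub (Ar_Ob Uf).1 (Ob_ker Uf) (Ob_ker Ug)).
have := rank_nullity Uf; rewrite (rank_nullity Ug).
lia.
Qed.

Lemma rank_comp_le V W X (f : {additive V -> W}) (g : {additive W -> X}) :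
  Ar U f -> Ar U g -> (rank (g \o f) <= rank f)%N.
Proof.
move=> Uf Ug; apply: (rank_ker_sub Uf (Ar_comp Uf Ug)) => v.
by rewrite !in_ker /= => /eqP ->; rewrite raddf0.
Qed.

Lemma rank_comp_surj V W X (f : {additive V -> W}) (g : {additive W -> X}) :
  (forall w, exists v, f v = w) -> rank (g \o f) = rank g.
Proof.
move=> f_surj; apply: eq_dim => x; apply/asboolP/asboolP => [[v <-]|[w <-]].
  by exists (f v).
by have [v <-] := f_surj w; exists v.
Qed.

Lemma rank_surj V W (f : {additive V -> W}) :
  Ob U W -> (forall w, exists v, f v = w) -> rank f = dim W.
Proof.
move=> UW f_surj; rewrite -(rank_inj (Ar_id UW)) //.
by rewrite -(rank_comp_surj idfun f_surj); congr rank; exact: additive_ext.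
Qed.

(* The restriction of (1 + t)f to the kernel of (1 - t)f still has image
   im (1 + t)f, and its kernel lies between ker f and ker 2f, which have the
   same dimension. *)
Lemma rank_split V W (f : {additive V -> W}) (s : {additive V -> V})
    (t : {additive W -> W}) :
  divisible 2 V -> Ar U f -> Ar U s -> Ar U t ->
  involutive s -> f \o s =1 t \o f ->
  rank f = (rank ((idfun \+ t) \o f) + rank ((idfun \- t) \o f))%N.
Proof.
move=> V2 Uf Us Ut ss fs; have [UV UW] := Ar_Ob Uf.
pose fp : {additive V -> W} := (idfun \+ t) \o f.
pose fm : {additive V -> W} := (idfun \- t) \o f.
rewrite -[X in (X + _)%N]/(rank fp) -[X in (_ + X)%N]/(rank fm).
have Ufp : Ar U fp := Ar_comp Uf (Ar_addf (Ar_id UW) Ut).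
have Ufm : Ar U fm := Ar_comp Uf (Ar_subf (Ar_id UW) Ut).
have fpE v : fp v = f v + f (s v) by rewrite [f (s v)]fs.
have fmE v : fm v = f v - f (s v) by rewrite [f (s v)]fs.
pose i : {additive subgrp (ker fm) -> V} := val.
have Ui : Ar U i := Ar_incl UV (Ob_ker Ufm).
have Ufi : Ar U (fp \o i) := Ar_comp Ui Ufp.
have r_fp : rank (fp \o i) = rank fp.
  apply: eq_dim => w; apply/asboolP/asboolP => [[v <-]|[v <-]].
    by exists (i v).
  (* If v = 2u, then [u + s u] is in [ker fm], and [fp (u + s u)] is 2 [fp u], that is [fp v],
     because [fp (s u) = fp u]. *)
  have [u ->] := V2 v.
  have ku : u + s u \in ker fm.
    by rewrite in_ker fmE [s (_ + _)]raddfD ss [s u + u]addrC subrr.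
  exists (SubGrp ku); rewrite -[LHS]/(fp (u + s u)) !fpE.
  by rewrite mulr2n !raddfD ss [X in _ + X = _]addrC addrACA.
pose j : {additive subgrp (ker (fp \o i)) -> V} := i \o val.
have Uj : Ar U j := Ar_comp (Ar_incl (Ob_ker Ufm) (Ob_ker Ufi)) Ui.
pose f2 : {additive V -> W} := f \o mulz_map 2.
have Uf2 : Ar U f2 := Ar_comp (Ar_mulz 2 UV) Uf.
have r_f2 : rank f2 = rank f.
  by apply: rank_comp_surj => v; have [w ->] := V2 v; exists w.
have le_f_j : (dim (subgrp (ker f)) <= rank j)%N.
  apply: (dim_sub UV (Ob_ker Uf) (Ob_im Uj)) => v kv.
  have fv : f v = 0 by exact/eqP.
  have fsv : f (s v) = 0 by rewrite [LHS]fs /= fv raddf0.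
  have mv : v \in ker fm by rewrite in_ker fmE fv fsv subr0.
  have pv : SubGrp mv \in ker (fp \o i).
    by rewrite in_ker -[_ (SubGrp mv)]/(fp v) fpE fv fsv addr0.
  by apply/asboolP; exists (SubGrp pv).
have le_j_f2 : (rank j <= dim (subgrp (ker f2)))%N.
  apply: (dim_sub UV (Ob_im Uj) (Ob_ker Uf2)) => _ /asboolP[x <-].
  have /eqP fm0 : fm (j x) == 0 := valP (val x).
  have /eqP fp0 : fp (j x) == 0 := valP x.
  rewrite in_ker /= [mulz_map _ _]mulr2n raddfD.
  by rewrite -[X in X + _](subrK (f (s (j x)))) -fmE fm0 add0r addrC -fpE fp0.
have dV : dim V = (dim (subgrp (ker f)) + rank f)%N := rank_nullity Uf.
have dV2 : dim V = (dim (subgrp (ker f2)) + rank f)%N.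
  by rewrite -r_f2; exact: rank_nullity.
have dVj : dim V = (rank j + rank fp + rank fm)%N.
  rewrite (rank_nullity Ufm) (rank_inj Uj) => [|x y /val_inj/val_inj//].
  by rewrite -r_fp; congr (_ + _)%N; exact: rank_nullity.
lia.
Qed.
End Rank.

(** * The eigenspaces of the Klein group *)

Section Conjugate.
Variables (U : modular_universe) (dim : additive_dimension U) (V : zmodType).
Implicit Types f g s : {additive V -> V}.

(** Composing with [s] on either side does not raise the rank, and [f] is in turn the conjugate of
    [g]. *)
Lemma rank_conj f g s :
  Ar U f -> Ar U s -> involutive s -> (forall v, g v = s (f (s v))) ->
  rank dim g = rank dim f.
Proof.
move=> Uf Us ss gE.
have s_surj v : exists w, s w = v by exists (s v).
have le_conj h : Ar U h -> (rank dim (s \o (h \o s)) <= rank dim h)%N.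
  move=> Uh; rewrite -(rank_comp_surj dim h s_surj).
  exact: (rank_comp_le dim (Ar_comp Us Uh) Us).
have -> : g = s \o (f \o s) by exact: additive_ext.
have Usfs : Ar U (s \o (f \o s)) := Ar_comp (Ar_comp Us Uf) Us.
apply/eqP; rewrite eqn_leq le_conj //=.
have {1}-> : f = s \o ((s \o (f \o s)) \o s).
  by apply/additive_ext => v; rewrite /= !ss.
exact: le_conj.
Qed.

Lemma rank_eq0 f :
  Ar U f -> dim_connected dim V -> rank dim f = 0%N -> forall v, f v = 0.
Proof.
move=> Uf Vc f0 v; apply: contrapT => fv.
have := Vc (ker f) (Ob_ker Uf); rewrite (rank_nullity dim Uf) f0 addn0 ltnn.
move=> kf; suff: false by []; apply: kf.
by exists v; rewrite in_ker; apply/eqP.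
Qed.
End Conjugate.

Section Klein.
Variables (U : modular_universe) (dim : additive_dimension U) (V : zmodType).
Variables p q r : {additive V -> V}.
Hypotheses (Up : Ar U p) (Uq : Ar U q) (Ur : Ar U r).
Hypotheses (pK : involutive p) (qK : involutive q) (rK : involutive r).
Hypothesis prC : forall v, p (r v) = r (p v).
Hypothesis pqp : forall v, p (q (p v)) = q (p (q v)).
Hypothesis qrq : forall v, q (r (q v)) = r (q (r v)).

Let a : {additive V -> V} := p \o r.
Let b : {additive V -> V} := q \o (a \o q).
(* 1 + a - b - c, where c = a b; the spurious idfun makes the terms below
   instances of rank_split. *)
Definition klein_proj : {additive V -> V} :=
  (idfun \- b) \o ((idfun \+ a) \o idfun).

(** Together with [klein_proj], these are the products of 1 + a or 1 - a with 1 + b or 1 - b. Their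
    values lie in the joint eigenspaces of a, b with signs (1, 1), (-1, 1), (-1, -1), those of
    [klein_proj] in the one with signs (1, -1). *)
Let P1 : {additive V -> V} := (idfun \+ b) \o ((idfun \+ a) \o idfun).
Let Pb : {additive V -> V} := (idfun \+ b) \o ((idfun \- a) \o idfun).
Let Pc : {additive V -> V} := (idfun \- b) \o ((idfun \- a) \o idfun).

Let aK : involutive a. Proof. by move=> v; rewrite /a /= -prC rK pK. Qed.
Let bK : involutive b. Proof. by move=> v; rewrite /b /= qK [p _]aK qK. Qed.

(** In Sym(4), b is (02)(13), and conjugation by (23) turns it into c = (03)(12), the product of a
    and b. *)
Let rbr v : r (b (r v)) = a (b v).
Proof. by rewrite /b /a /= -qrq -pqp !prC. Qed.

Let abC v : a (b v) = b (a v).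
Proof. by rewrite -rbr /b /a /= !prC -qrq -pqp !prC. Qed.

Let pb v : p (b v) = a (b (p v)).
Proof.
rewrite abC -[v in LHS]pK; set w := p v.
by rewrite /b /a /= pqp qrq -prC.
Qed.

Let P_sum v : P1 v + klein_proj v + (Pb v + Pc v) = v *+ 4.
Proof.
have split2 (f : {additive V -> V}) w : (w + f w) + (w - f w) = w *+ 2.
  by rewrite addrACA subrr addr0.
rewrite /P1 /klein_proj /Pb /Pc /= !(split2 b) -mulrnDl (split2 a).
by rewrite -mulrnA.
Qed.

(** Conjugation by q exchanges a and b and fixes c, hence turns 1 + a - b - c into 1 - a + b - c. *)
Let PbE v : Pb v = q (klein_proj (q v)).
Proof.
have -> : q (klein_proj (q v)) = (v + b v) - a (v + b v).
  have qb w : q (b w) = a (q w) by rewrite /b /= qK.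
  have qw : q (q v + a (q v)) = v + b v by rewrite raddfD qK.
  by rewrite -[klein_proj _]/((q v + a (q v)) - b (q v + a (q v))) raddfB qb qw.
rewrite -[LHS]/((v - a v) + b (v - a v)) [b _]raddfB.
by rewrite [a (_ + _)]raddfD abC opprD addrACA.
Qed.

Let PcE v : Pc v = r (Pb (r v)).
Proof.
have arE w : r (a (r w)) = a w by rewrite /a /= rK prC.
have -> : r (Pb (r v)) = (v - a v) + b (a (v - a v)).
  have rb w : r (b w) = a (b (r w)) by rewrite -rbr rK.
  have rw : r (r v - a (r v)) = v - a v by rewrite raddfB rK arE.
  by rewrite -[Pb _]/((r v - a (r v)) + b (r v - a (r v))) raddfD rb rw abC.
have -> : Pc v = (v - a v) - b (v - a v) by [].
by congr (_ + _); rewrite -raddfN opprB [a (_ - _)]raddfB aK.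
Qed.

(** Conjugation by p fixes a and exchanges b and c, which have the same sign in 1 + a - b - c. *)
Let klein_projp v : klein_proj (p v) = p (klein_proj v).
Proof.
have apC w : a (p w) = p (a w) by rewrite /a /= !prC.
have pw : p (v + a v) = p v + a (p v) by rewrite raddfD apC.
rewrite -[klein_proj v]/((v + a v) - b (v + a v)) raddfB pb pw.
rewrite -[LHS]/((p v + a (p v)) - b (p v + a (p v))); congr (_ - _).
by rewrite abC [a (_ + _)]raddfD aK addrC.
Qed.

(** This comes from a(1 + a) = 1 + a and b(1 - b) = -(1 - b), as a and b commute. *)
Lemma klein_proj_eigen :
  [/\ forall v, p (r (klein_proj v)) = klein_proj v
    & forall v, q (p (r (q (klein_proj v)))) = - klein_proj v].
Proof.
split=> v; last first.
  rewrite -[LHS]/(b (klein_proj v)) -[klein_proj v]/((v + a v) - b (v + a v)).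
  by rewrite raddfB bK opprB.
rewrite -[LHS]/(a (klein_proj v)) -[klein_proj v]/((v + a v) - b (v + a v)).
by rewrite raddfB abC [a (_ + _)]raddfD aK [a v + v]addrC.
Qed.

Lemma Ar_klein_proj : Ar U klein_proj.
Proof.
have [UV _] := Ar_Ob Up; have U1 := Ar_id UV.
have Ua : Ar U a := Ar_comp Ur Up.
have Ub : Ar U b := Ar_comp (Ar_comp Uq Ua) Uq.
exact: (Ar_comp (Ar_comp U1 (Ar_addf U1 Ua)) (Ar_subf U1 Ub)).
Qed.

Hypotheses (dV : dim V = 3%N) (Vc : dim_connected dim V).
Hypothesis V2 : divisible 2 V.
Hypothesis pr_neq1 : ~ forall v, p (r v) = v.

Lemma klein_structure :
  [/\ rank dim klein_proj = 1%N,
      forall v, v *+ 4 = klein_proj v + q (klein_proj (q v))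
                         + r (q (klein_proj (q (r v))))
    & (forall v, p (klein_proj v) = klein_proj v) \/
      (forall v, p (klein_proj v) = - klein_proj v)].
Proof.
have [UV _] := Ar_Ob Up; have U1 := Ar_id UV.
have Ua : Ar U a := Ar_comp Ur Up.
have Ub : Ar U b := Ar_comp (Ar_comp Uq Ua) Uq.
have Up1 (f : {additive V -> V}) : Ar U f -> Ar U (idfun \+ f).
  exact: (Ar_addf U1).
have Um1 (f : {additive V -> V}) : Ar U f -> Ar U (idfun \- f).
  exact: (Ar_subf U1).
have UPp : Ar U ((idfun \+ a) \o idfun) := Ar_comp U1 (Up1 _ Ua).
have UPm : Ar U ((idfun \- a) \o idfun) := Ar_comp U1 (Um1 _ Ua).
have UP1 : Ar U P1 := Ar_comp UPp (Up1 _ Ub).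
have UPa := Ar_klein_proj.
have UPb : Ar U Pb := Ar_comp UPm (Up1 _ Ub).
have UPc : Ar U Pc := Ar_comp UPm (Um1 _ Ub).
have rkb : rank dim Pb = rank dim klein_proj := rank_conj dim UPa Uq qK PbE.
have rkc : rank dim Pc = rank dim Pb := rank_conj dim UPb Ur rK PcE.
have rk : (3 = (rank dim P1 + rank dim klein_proj) +
               (rank dim Pb + rank dim Pc))%N.
  rewrite -dV -(rank_inj dim U1) // (rank_split dim V2 U1 Ua Ua aK) //.
  congr (_ + _)%N; apply: (rank_split dim V2 _ Ub Ub bK) => // v.
    by rewrite -[RHS]/(b (v + a v)) raddfD -abC.
  by rewrite -[RHS]/(b (v - a v)) raddfB -abC.
have V4 (v : V) : exists w, v = w *+ 4.
  by have [u ->] := V2 v; have [w ->] := V2 u; exists w; rewrite -mulrnA.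
have rk1 : rank dim klein_proj = 1%N.
  (* Three of the four ranks are equal, so each of these is 0 or 1. If 0, then 4w = [P1 w] for all
     w; every vector is some 4w and a fixes the values of [P1], so a would be trivial. *)
  suffices rk0 : rank dim klein_proj <> 0%N by lia.
  move=> rk0; apply: pr_neq1 => v; rewrite -[LHS]/(a v); have [w ->] := V4 v.
  rewrite -P_sum; have [rkb0 rkc0] : rank dim Pb = 0%N /\ rank dim Pc = 0%N.
    by rewrite rkc rkb.
  rewrite (rank_eq0 UPa Vc rk0) (rank_eq0 UPb Vc rkb0) (rank_eq0 UPc Vc rkc0).
  rewrite !addr0 -[P1 w]/((w + a w) + b (w + a w)).
  by rewrite raddfD abC [a (_ + _)]raddfD aK [a w + w]addrC.
have rkP1 : rank dim P1 = 0%N by lia.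
split=> // [v|].
  by rewrite -P_sum (rank_eq0 UP1 Vc rkP1) add0r PcE !PbE addrA.
have := rank_split dim V2 UPa Up Up pK klein_projp; rewrite rk1.
set fp := _ \o _; set fm := (_ \- _) \o _.
have Ufp : Ar U ((idfun \+ p) \o klein_proj) := Ar_comp UPa (Up1 _ Up).
have Ufm : Ar U ((idfun \- p) \o klein_proj) := Ar_comp UPa (Um1 _ Up).
move=> rk_pm.
have [fm0|fp0] : rank dim fm = 0%N \/ rank dim fp = 0%N by lia.
  left=> v; apply/esym/eqP; rewrite -subr_eq0.
  exact/eqP/(rank_eq0 Ufm Vc fm0).
right=> v; apply/eqP; rewrite -addr_eq0 addrC.
exact/eqP/(rank_eq0 Ufp Vc fp0).
Qed.
End Klein.

(** * Generators of Sym(4) and the isogeny *)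

(* action.actM and action.act1 are restricted to actions on finite types. *)
Section TotalAction.
Variables (gT : finGroupType) (T : Type) (to : {action gT &-> T}).

Lemma total_actM x g h : to x (g * h)%g = to (to x g) h.
Proof. by case: to => f [fI fM]; apply: fM; rewrite inE. Qed.

Lemma total_act1 x : to x 1%g = x.
Proof.
have act_inj : left_injective to by case: to => ? [].
by apply: (act_inj 1%g); rewrite -total_actM mulg1.
Qed.

Lemma total_actK2 x g : (g * g = 1)%g -> to (to x g) g = x.
Proof. by rewrite -total_actM => ->; exact: total_act1. Qed.
End TotalAction.

Definition o1 : 'I_4 := Ordinal (isT : 1 < 4)%N.
Definition o2 : 'I_4 := Ordinal (isT : 2 < 4)%N.
Definition o3 : 'I_4 := Ordinal (isT : 3 < 4)%N.
Definition s01 : 'S_4 := tperm ord0 o1.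
Definition s12 : 'S_4 := tperm o1 o2.
Definition s23 : 'S_4 := tperm o2 o3.

Lemma ord4_ind (P : 'I_4 -> Prop) :
  P ord0 -> P o1 -> P o2 -> P o3 -> forall i, P i.
Proof.
move=> P0 P1 P2 P3 [[|[|[|[|//]]]] i4].
- by rewrite (_ : Ordinal i4 = ord0) //; exact: val_inj.
- by rewrite (_ : Ordinal i4 = o1) //; exact: val_inj.
- by rewrite (_ : Ordinal i4 = o2) //; exact: val_inj.
- by rewrite (_ : Ordinal i4 = o3) //; exact: val_inj.
Qed.

Lemma sum_ord4 (V : zmodType) (F : 'I_4 -> V) :
  \sum_i F i = F ord0 + F o1 + F o2 + F o3.
Proof.
rewrite !big_ord_recl big_ord0 addr0 !addrA.
by congr (_ + F _ + F _ + F _); exact: val_inj.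
Qed.

(** The other transpositions are conjugates of the three given ones; the inverses needed for
    conjugating are those of involutions. *)
Lemma Sym4_ind (P : 'S_4 -> Prop) :
  P s01 -> P s12 -> P s23 -> (forall g h, P g -> P h -> P (g * h)%g) ->
  forall g, P g.
Proof.
move=> P01 P12 P23 PM.
have P1 : P 1%g by rewrite -(tperm2 ord0 o1); exact: PM.
have PJ g h : P g -> P h -> P h^-1%g -> P (g ^ h)%g.
  by move=> Pg Ph Pi; rewrite conjgE; apply: (PM _ _ Pi); exact: PM.
have P02 : P (tperm ord0 o2).
  have -> : tperm ord0 o2 = (s01 ^ s12)%g by rewrite tpermJ tpermD // tpermL.
  by apply: PJ; rewrite ?tpermV.
have P13 : P (tperm o1 o3).
  have -> : tperm o1 o3 = (s12 ^ s23)%g by rewrite tpermJ tpermD // tpermL.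
  by apply: PJ; rewrite ?tpermV.
have P03 : P (tperm ord0 o3).
  have -> : tperm ord0 o3 = (s01 ^ tperm o1 o3)%g.
    by rewrite tpermJ tpermD // tpermL.
  by apply: PJ; rewrite ?tpermV.
have Pt i j : P (tperm i j).
  by elim/ord4_ind: i; elim/ord4_ind: j; rewrite ?tperm1 // tpermC.
move=> g; have [ts -> _] := prod_tpermP g.
by elim: ts => [|t ts IHts]; rewrite ?big_nil // big_cons; exact: PM.
Qed.

Lemma equivariant_Sym4 (S T : Type) (toS : {action 'S_4 &-> S})
    (toT : {action 'S_4 &-> T}) (f : S -> T) :
  (forall x, f (toS x s01) = toT (f x) s01) ->
  (forall x, f (toS x s12) = toT (f x) s12) ->
  (forall x, f (toS x s23) = toT (f x) s23) -> equivariant toS toT f.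
Proof.
move=> f01 f12 f23 x g; elim/Sym4_ind: g x => // g h fg fh x.
by rewrite !total_actM fh fg.
Qed.

(** Transpositions being involutions, both sides are conjugates of a transposition, and both equal
    (x z). *)
Lemma tperm_braid (T : finType) (x y z : T) : x != y -> y != z -> x != z ->
  (tperm x y * (tperm y z * tperm x y) = tperm y z * (tperm x y * tperm y z))%g.
Proof.
move=> xy yz xz.
rewrite -[X in (X * _)%g = _]tpermV -[X in _ = (X * _)%g]tpermV.
rewrite -!conjgE.
by rewrite !tpermJ !tpermL !tpermR !tpermD // eq_sym.
Qed.

Lemma Sym4_commute : (s01 * s23 = s23 * s01)%g.
Proof.
have := tpermJ ord0 o1 s23; rewrite conjgE tpermV !tpermD // -/s01 => s01J.
by rewrite -[in RHS]s01J !mulgA tperm2 mul1g.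
Qed.

(** * The map from std(4, L) to V, its kernel and its image *)

Section Isogeny.
Variables (V : zmodType) (L : zmodClosed V) (p q r : {additive V -> V}).
Let stdL := std 4 (subgrp L).

Definition std_coord (i : 'I_4) : {additive stdL -> V} :=
  val \o (coord_at i \o val).

(* On std(4, L), l0 + l1 is half of l0 + l1 - l2 - l3, the component of l
   attached to the partition 01|23; q and r q map L to the eigenspaces of
   02|13 and 03|12. *)
Definition std_phi : {additive stdL -> V} :=
  (std_coord ord0 \+ std_coord o1)
  \+ ((q \o (std_coord ord0 \+ std_coord o2))
      \+ (r \o (q \o (std_coord ord0 \+ std_coord o3)))).

Lemma std_coordL i x : std_coord i x \in L.
Proof. exact: (valP (coord_at i (val x))). Qed.

Lemma std_coord_act i x g :
  std_coord i (std_act x g) = std_coord (g^-1%g i) x.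
Proof. exact: (congr1 val (coord_std_act x g i)). Qed.

Lemma std_coord_sum x :
  std_coord ord0 x + std_coord o1 x + std_coord o2 x + std_coord o3 x = 0.
Proof.
have /eqP/(congr1 val) := valP x; rewrite raddf0 /sum_map raddf_sum => <-.
by rewrite sum_ord4.
Qed.

Lemma std_coord_inj x y : (forall i, std_coord i x = std_coord i y) -> x = y.
Proof.
by move=> xy; apply/val_inj/coord_inj => i; apply/val_inj/xy.
Qed.

Hypotheses (qK : involutive q) (rK : involutive r).
Hypothesis prC : forall v, p (r v) = r (p v).
Hypothesis qrq : forall v, q (r (q v)) = r (q (r v)).
Hypothesis pL : {in L, forall v, p v = v}.
Hypothesis rL : {in L, forall v, r v = v}.
Hypothesis bL : {in L, forall v, q (p (r (q v))) = - v}.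

Let phiE x : std_phi x = (std_coord ord0 x + std_coord o1 x)
  + (q (std_coord ord0 x + std_coord o2 x)
     + r (q (std_coord ord0 x + std_coord o3 x))).
Proof. by []. Qed.

Let bL' : {in L, forall v, p (r (q v)) = - q v}.
Proof. by move=> v Lv; rewrite -[LHS]qK bL // raddfN. Qed.

Let cL : {in L, forall v, p (q v) = - r (q v)}.
Proof. by move=> v Lv; rewrite -[LHS]rK -prC bL' // raddfN. Qed.

(** For l in L, p fixes l, sends q l to - r q l and r q l to - q l. The signs are absorbed by x0 +
    x2 = -(x1 + x3) and x0 + x3 = -(x1 + x2). *)
Lemma std_phi_s01 x : std_phi (std_act x s01) = p (std_phi x).
Proof.
rewrite !phiE !std_coord_act !tpermV tpermL tpermR !tpermD //.
have [L0 L1 L2 L3] := And4 (std_coordL ord0 x) (std_coordL o1 x)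
  (std_coordL o2 x) (std_coordL o3 x).
move: (std_coord_sum x) L0 L1 L2 L3.
set x0 := std_coord ord0 x; set x1 := std_coord o1 x.
set x2 := std_coord o2 x; set x3 := std_coord o3 x.
move=> x_sum L0 L1 L2 L3; have e3 : x0 + x3 = - (x1 + x2).
  apply/eqP; rewrite -addr_eq0; apply/eqP; rewrite -x_sum.
  by rewrite -!addrA [x3 + _]addrC !addrA.
have e2 : x0 + x2 = - (x1 + x3).
  apply/eqP; rewrite -addr_eq0; apply/eqP; rewrite -x_sum.
  by rewrite -!addrA; congr (_ + _); rewrite addrCA.
rewrite [p _]raddfD [p (q _ + _)]raddfD pL ?cL ?bL' ?rpredD // e2 e3 !raddfN.
by rewrite !opprK [x1 + x0]addrC; congr (_ + _); exact: addrC.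
Qed.

(** q exchanges the first two terms and fixes the third, because q r q = r q r and r is 1 on L. *)
Lemma std_phi_s12 x : std_phi (std_act x s12) = q (std_phi x).
Proof.
rewrite !phiE !std_coord_act !tpermV tpermL tpermR !tpermD //.
set y := std_coord ord0 x + std_coord o3 x.
have Ly : y \in L by rewrite rpredD ?std_coordL.
rewrite [in RHS]raddfD [X in _ = _ + X]raddfD qK qrq (rL Ly).
by rewrite addrCA addrA.
Qed.

Lemma std_phi_s23 x : std_phi (std_act x s23) = r (std_phi x).
Proof.
rewrite !phiE !std_coord_act !tpermV tpermL tpermR !tpermD //.
set y := std_coord ord0 x + std_coord o1 x.
have Ly : y \in L by rewrite rpredD ?std_coordL.
rewrite [in RHS]raddfD [X in _ = _ + X]raddfD rK (rL Ly).
by congr (_ + _); exact: addrC.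
Qed.

(** p r is 1 on L and -1 on q L and r q L, so applying 1 + p r to [std_phi x] leaves twice its first
    term. *)
Lemma std_phi_ker x : std_phi x = 0 ->
  (std_coord ord0 x + std_coord o1 x) *+ 2 = 0.
Proof.
move=> phi0; have : p (r (std_phi x)) + std_phi x = 0.
  by rewrite phi0 !raddf0 addr0.
rewrite phiE; set u := std_coord ord0 x + std_coord o1 x.
set y := std_coord ord0 x + std_coord o2 x.
set z := std_coord ord0 x + std_coord o3 x.
have [Lu Ly Lz] : [/\ u \in L, y \in L & z \in L].
  by rewrite !rpredD ?std_coordL.
rewrite [r _]raddfD [p (_ + _)]raddfD [r (q _ + _)]raddfD rK [p (_ + _)]raddfD.
rewrite bL' // cL // rL // pL // addrACA -opprD [q y + _]addrC.
by rewrite [r (q z) + _]addrC addNr addr0.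
Qed.

Lemma std_phi_ker_act x : std_phi x = 0 -> forall g, std_phi (std_act x g) = 0.
Proof.
move=> phi0 g; elim/Sym4_ind: g x phi0 => [x|x|x|g h IHg IHh x].
- by rewrite std_phi_s01 => ->; rewrite raddf0.
- by rewrite std_phi_s12 => ->; rewrite raddf0.
- by rewrite std_phi_s23 => ->; rewrite raddf0.
by move=> /IHg/IHh; rewrite std_actM.
Qed.

(** The kernel is stable under Sym(4), so permuting coordinates gives 2(l0 + l1) = 2(l0 + l2) = 2(l1
    + l2) = 0; then 4 l0 is the sum of the first two minus the third. A transposition brings any
    coordinate to position 0. *)
Lemma std_phi_ker4 x : std_phi x = 0 -> x *+ 4 = 0.
Proof.
have ker0 y : std_phi y = 0 -> std_coord ord0 y *+ 4 = 0.
  move=> phi0; have y01 := std_phi_ker phi0.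
  have := std_phi_ker (std_phi_ker_act phi0 s12).
  rewrite !std_coord_act tpermV tpermL tpermD // => y02.
  have := std_phi_ker (std_phi_ker_act phi0 (tperm ord0 o2)).
  rewrite !std_coord_act tpermV tpermL tpermD // => y12.
  transitivity ((std_coord ord0 y + std_coord o1 y) *+ 2
    + (std_coord ord0 y + std_coord o2 y) *+ 2
    - (std_coord o2 y + std_coord o1 y) *+ 2).
    rewrite -mulrnDl -mulrnBl addrACA [std_coord o1 y + _]addrC addrK.
    by rewrite -mulr2n -mulrnA.
  by rewrite y01 y02 y12 addr0 subr0.
move=> phi0; apply: std_coord_inj => i; rewrite raddfMn raddf0.
have := ker0 _ (std_phi_ker_act phi0 (tperm ord0 i)).
by rewrite std_coord_act tpermV tpermL.
Qed.

(** On (v, v, -v, -v) both l0 + l2 and l0 + l3 vanish. *)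
Lemma std_phi_block v : v \in L -> exists x, std_phi x = v *+ 2.
Proof.
move=> Lv; pose u : subgrp L := SubGrp Lv.
pose x := mkpow (fun i : 'I_4 => if (i < 2)%N then u else - u).
have kx : x \in ker (@sum_map (subgrp L) 4).
  rewrite in_ker; apply/eqP; rewrite [LHS]sum_ord4 !coord_mkpow [LHS]/=.
  by rewrite addrK subrr.
exists (SubGrp kx); rewrite phiE.
have xE i : std_coord i (SubGrp kx) = val (if (i < 2)%N then u else - u).
  by congr val; exact: coord_mkpow.
by rewrite !xE /= subrr !raddf0 !addr0.
Qed.

Lemma std_phi_surj : divisible 2 V ->
  (forall v, exists a b c, [/\ a \in L, b \in L, c \in L
                             & v *+ 4 = a + q b + r (q c)]) ->
  forall v, exists x, std_phi x = v.
Proof.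
(* The vector is written as 8w: [span] uses a factor 4 and [std_phi_block] a factor 2. *)
move=> V2 span v; have [v1 ->] := V2 v; have [v2 ->] := V2 v1.
have [w ->] := V2 v2; rewrite -!mulrnA.
have [a [b [c [La Lb Lc vE]]]] := span w.
have [x xE] := std_phi_block La; have [y yE] := std_phi_block Lb.
have [z zE] := std_phi_block Lc.
(* [s12] carries the L term to q L, and [s23] then carries it to r q L. *)
exists (x + std_act y s12 + std_act (std_act z s12) s23).
rewrite !raddfD std_phi_s23 !std_phi_s12 xE yE zE !raddfMn -!mulrnDl -vE.
by rewrite -mulrnA.
Qed.

(** Halves are defined only up to elements killed by 2, so halving all four coordinates could break
    the zero sum; the last one is instead minus the sum of the others. *)
Lemma std_div2 : divisible 2 (subgrp L) -> divisible 2 stdL.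
Proof.
move=> /choice[h hE] x; pose xi := coord (val x).
pose s := h (xi ord0) + h (xi o1) + h (xi o2).
pose y := mkpow (fun i : 'I_4 => if (i < 3)%N then h (xi i) else - s).
have ky : y \in ker (@sum_map (subgrp L) 4).
  rewrite in_ker; apply/eqP; rewrite [LHS]sum_ord4 !coord_mkpow [LHS]/=.
  by rewrite subrr.
exists (SubGrp ky); apply: std_coord_inj => i; rewrite raddfMn.
have yE j : std_coord j (SubGrp ky) = val (if (j < 3)%N then h (xi j) else - s).
  by congr val; exact: coord_mkpow.
elim/ord4_ind: i; rewrite yE [X in val X]/= -[RHS](raddfMn val) -?hE //.
rewrite mulNrn /s !mulrnDl -!hE [RHS]raddfN !(raddfD val).
by apply/eqP; rewrite -addr_eq0 addrC; apply/eqP; exact: (std_coord_sum x).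
Qed.

Lemma Ar_std_phi (U : modular_universe) :
  Ob U V -> Ob U (subgrp L) -> Ar U q -> Ar U r -> Ar U std_phi.
Proof.
move=> UV UL Uq Ur.
have Uc i : Ar U (std_coord i).
  apply: (Ar_comp _ (Ar_incl UV UL)); apply: (Ar_comp _ (Ar_coord i UL)).
  by apply: Ar_incl; [exact: Ob_pow | exact: (Ob_ker (Ar_sum_map UL _))].
apply: Ar_addf; first exact: (Ar_addf (Uc _) (Uc _)).
apply: Ar_addf.
  exact: (Ar_comp (Ar_addf (Uc _) (Uc _)) Uq).
exact: (Ar_comp (Ar_comp (Ar_addf (Uc _) (Uc _)) Uq) Ur).
Qed.

(** Multiplication by 4 is onto std(4, L), so its kernel has dimension 0, and this kernel contains
    that of [std_phi]. *)
Lemma std_phi_isogeny (U : modular_universe) (dim : additive_dimension U) :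
  Ob U V -> Ob U (subgrp L) -> Ar U q -> Ar U r ->
  divisible 2 V -> divisible 2 (subgrp L) ->
  (forall v, exists a b c, [/\ a \in L, b \in L, c \in L
                             & v *+ 4 = a + q b + r (q c)]) ->
  dim_isogeny dim std_phi /\
  ((forall v : V, v *+ 2 = 0 -> v = 0) -> bijective std_phi).
Proof.
move=> UV UL Uq Ur V2 L2 span; have Uphi := Ar_std_phi UV UL Uq Ur.
have phi_surj := std_phi_surj V2 span; split.
  split=> //; have [Ustd _] := Ar_Ob Uphi.
  pose m4 : {additive stdL -> stdL} := mulz_map 4.
  have Um4 : Ar U m4 := Ar_mulz 4 Ustd.
  have m4_surj x : exists y, m4 y = x.
    have [y ->] := std_div2 L2 x; have [z ->] := std_div2 L2 y.
    by exists z; rewrite -mulrnA.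
  have le_ker : (dim (subgrp (ker std_phi)) <= dim (subgrp (ker m4)))%N.
    apply: (dim_sub dim Ustd (Ob_ker Uphi) (Ob_ker Um4)) => x /eqP phi0.
    by rewrite in_ker; apply/eqP; exact: std_phi_ker4.
  have dstd : dim stdL = (dim (subgrp (ker m4)) + dim stdL)%N.
    by rewrite -[in RHS](rank_surj dim Ustd m4_surj); exact: rank_nullity.
  lia.
move=> V_tf; have [psi psiK] := choice phi_surj.
have phi_inj : injective std_phi.
  move=> x y xy; apply/eqP; rewrite -subr_eq0; apply/eqP.
  have /std_phi_ker4 xy4 : std_phi (x - y) = 0 by rewrite raddfB xy subrr.
  (* The coordinates are elements of [V] killed by 4, so cancelling 2 twice makes them vanish. *)
  apply: std_coord_inj => i; rewrite [RHS]raddf0; apply/V_tf/V_tf.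
  by rewrite -mulrnA -[LHS]raddfMn xy4 raddf0.
by exists psi => // x; apply: phi_inj; rewrite psiK.
Qed.
End Isogeny.

(** * The two cases, untwisted and twisted by the signature *)

Lemma divisible_im n (V W : zmodType) (f : {additive V -> W}) :
  divisible n V -> divisible n (subgrp (im f)).
Proof.
move=> Vn x; have /asboolP[v vx] := valP x; have [w wE] := Vn v.
have fw : f w \in im f by apply/asboolP; exists w.
by exists (SubGrp fw); apply: val_inj; rewrite raddfMn /= -raddfMn -wE vx.
Qed.

Theorem lemma4p7
  (U : modular_universe) (dim : additive_dimension U)
  (V : zmodType) (to : {action 'S_4 &-> V})
  (V_Mod : in_Mod dim 3 to)
  (V_faithful : faithful_action to)
  (V_2div : divisible 2 V) :
  exists L : zmodClosed V,
  exists phi : {additive std 4 (subgrp L) -> V},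
    [/\ submodule U L,
        dim (subgrp L) = 1%N,
        dim_isogeny dim phi,
        equivariant (std_action 4 (subgrp L)) to phi \/
        equivariant (stdsgn_action 4 (subgrp L)) to phi
      & (forall v : V, v *+ 2 = 0 -> v = 0) -> bijective phi].
Proof.
have [[UV Vact] dV Vc] := V_Mod.
have [p Up pE] := Vact s01; have [q Uq qE] := Vact s12.
have [r Ur rE] := Vact s23.
have pK : involutive p by move=> v; rewrite !pE total_actK2 // tperm2.
have qK : involutive q by move=> v; rewrite !qE total_actK2 // tperm2.
have rK : involutive r by move=> v; rewrite !rE total_actK2 // tperm2.
have prC v : p (r v) = r (p v).
  by rewrite !pE !rE -!total_actM Sym4_commute.
have pqp v : p (q (p v)) = q (p (q v)).
  by rewrite !pE !qE -!total_actM tperm_braid.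
have qrq v : q (r (q v)) = r (q (r v)).
  by rewrite !rE !qE -!total_actM tperm_braid.
(* (01)(23) sends 2 to 3, so by faithfulness it acts nontrivially. *)
have pr_neq1 : ~ forall v, p (r v) = v.
  move=> pr1; have /permP/(_ o2) : (s23 * s01 = 1)%g.
    by apply: V_faithful => v; rewrite total_actM -rE -pE.
  by rewrite permM tpermL tpermD // perm1.
have [rk1 span p_pm] :=
  klein_structure Up Uq Ur pK qK rK prC pqp qrq dV Vc V_2div pr_neq1.
have [prP bP] := klein_proj_eigen pK qK rK prC pqp qrq.
set P := klein_proj p q r in rk1 span p_pm prP bP.
have UP : Ar U P by exact: Ar_klein_proj.
have UL := Ob_im UP; have L2 := divisible_im (f := P) V_2div.
have imP v : P v \in im P by apply/asboolP; exists v.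
have onL (Q : V -> Prop) : (forall v, Q (P v)) -> {in im P, forall v, Q v}.
  by move=> QP _ /asboolP[v <-].
have prL := onL (fun v => p (r v) = v) prP.
have bL := onL (fun v => q (p (r (q v))) = - v) bP.
have sgn_act x (s : 'S_4) : odd_perm s ->
    stdsgn_act x s = - std_act x s :> std 4 (subgrp (im P)).
  by rewrite /stdsgn_act => ->; rewrite expr1 mulrN1z.
have odd_s : [/\ odd_perm s01, odd_perm s12 & odd_perm s23].
  by rewrite !odd_tperm.
exists (im P : zmodClosed V).
case: p_pm => [/(onL (fun v => p v = v)) pL | /(onL (fun v => p v = - v)) pL].
  (* r agrees with p on L, because p r is 1 there. *)
  have rL : {in im P, forall v, r v = v}.
    by move=> v Lv; rewrite -[LHS]pK prL // pL.
  exists (std_phi (im P) q r).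
  have [||iso bij] :=
    std_phi_isogeny qK rK prC qrq pL rL bL dim UV UL Uq Ur V_2div.
  - exact: L2.
  - by move=> v; exists (P v), (P (q v)), (P (q (r v))).
  split=> //; left; apply: equivariant_Sym4 => x.
  - by rewrite (std_phi_s01 qK rK prC pL bL) pE.
  - by rewrite (std_phi_s12 qK qrq rL) qE.
  - by rewrite (std_phi_s23 q rK rL) rE.
(* Here p is -1 on L. The opposites satisfy the same relations, whose two sides have equal length,
   and b, a product of four generators, is unchanged. *)
pose p' : {additive V -> V} := \- p; pose q' : {additive V -> V} := \- q.
pose r' : {additive V -> V} := \- r.
have nn (f g : {additive V -> V}) v : (\- f) ((\- g) v) = f (g v).
  by rewrite /= raddfN opprK.
have q'K : involutive q' by move=> v; rewrite [LHS]nn qK.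
have r'K : involutive r' by move=> v; rewrite [LHS]nn rK.
have p'rC v : p' (r' v) = r' (p' v) by rewrite [LHS]nn [RHS]nn prC.
have q'rq v : q' (r' (q' v)) = r' (q' (r' v)).
  rewrite [LHS]nn [RHS]nn -[q' v]/(- q v) -[r' v]/(- r v).
  by rewrite !raddfN qrq.
have p'L : {in im P, forall v, p' v = v} by move=> v Lv; rewrite /= pL ?opprK.
have r'L : {in im P, forall v, r' v = v}.
  by move=> v Lv; rewrite -[LHS]/(- r v) -[r v]pK prL // pL // opprK.
have b'L : {in im P, forall v, q' (p' (r' (q' v))) = - v}.
  by move=> v Lv; rewrite [LHS]nn [r' _]nn bL.
have Uq' : Ar U q' := Ar_opp Uq; have Ur' : Ar U r' := Ar_opp Ur.
have [||iso bij] :=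
  std_phi_isogeny q'K r'K p'rC q'rq p'L r'L b'L dim UV UL Uq' Ur' V_2div.
- exact: L2.
(* r' q' = r q while q' = - q, whence the sign of the middle witness. *)
- move=> v; exists (P v), (- P (q v)), (P (q (r v))).
  by rewrite rpredN !imP [r' _]nn span -[q' _]/(- q _) [q (- _)]raddfN opprK.
exists (std_phi (im P) q' r').
have [o01 o12 o23] := odd_s.
(* On the odd generators the twisted action is minus the standard one, which cancels the signs of
   p', q', r'. *)
split=> //; right; apply: equivariant_Sym4 => x.
- by rewrite [_ x s01](sgn_act _ _ o01) raddfN
             (std_phi_s01 q'K r'K p'rC p'L b'L) /= opprK pE.
- by rewrite [_ x s12](sgn_act _ _ o12) raddfN
             (std_phi_s12 q'K q'rq r'L) /= opprK qE.
- by rewrite [_ x s23](sgn_act _ _ o23) raddfN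
             (std_phi_s23 q' r'K r'L) /= opprK rE.
Qed.
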